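(* Let $O=\{(x,y,z)\in\mathbb{E}^3:\ |x|+|y|+|z|\le 1\}$, let $r_1=\sqrt{2033}/57$ and let $\Gamma_1=r_1B$. Then $$m(\Gamma_1,O)\le 22.$$
   Context: $B$ is the closed unit ball of $\mathbb{E}^3$ centered at the origin ${\bf o}$. A convex body is a compact convex set with nonempty interior. For a discrete set $X$ of points, $K+X$ is called a packing if the translates $K+{\bf x}$, ${\bf x}\in X$, have pairwise disjoint interiors. For a point ${\bf x}$, $H_{\bf x}$ denotes the bisector of ${\bf o}$ and ${\bf x}$, i.e. $H_{\bf x}=\{{\bf y}:\ \langle {\bf x},{\bf y}\rangle=\frac12\langle{\bf x},{\bf x}\rangle\}$. For a centrally symmetric convex body $\Gamma$ centered at the origin (a ''truncater''), its colony is $\Gamma^*=\{{\bf x}:\ \Gamma\cap H_{\bf x}\ne\emptyset\}$ (for $\Gamma=rB$ this is $2rB$). For a centrally symmetric convex body $K$ centered at the origin, $K+{\bf x}$ is an effective neighbour of $K$ with respect to $\Gamma$ if ${\bf x}\in\Gamma^*$ and ${\rm int}(K)\cap(K+{\bf x})=\emptyset$. $m(\Gamma,K)$ is the maximal number of effective neighbours of $K$ with respect to $\Gamma$ in a packing $K+X$ with ${\bf o}\in X$; that is, the maximal number of points of $X\setminus\{{\bf o}\}$ lying in $\Gamma^*$, over all such packings. *)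

(* Defs.v *)
From HB Require Import structures.
From mathcomp Require Import all_boot all_order all_algebra.
From mathcomp Require Import all_classical all_reals all_analysis.
Import Order.TTheory GRing.Theory Num.Theory.
Import numFieldNormedType.Exports.

Set Implicit Arguments.
Unset Strict Implicit.
Unset Printing Implicit Defensive.

Local Open Scope classical_set_scope.
Local Open Scope ring_scope.

(* E^3 is 'rV[R]_3. The library norm on it is the sup norm, so the Euclidean
   norm is defined here; both induce the same topology, so interiors and
   discreteness are those of the library topology. *)
Section Truncaters.
Context {R : realType}.
Local Notation E3 := 'rV[R]_3.
Implicit Types (x y : E3) (K X Gamma : set E3).

Definition dot x y : R := \sum_i x 0 i * y 0 i.

Definition enorm x : R := Num.sqrt (dot x x).

Definition unit_ball : set E3 := [set x | enorm x <= 1].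

Definition octahedron : set E3 := [set x | \sum_i `|x 0 i| <= 1].

Definition dilate (r : R) K : set E3 := [set r *: y | y in K].

Definition translate K x : set E3 := [set y + x | y in K].

Definition bisector x : set E3 := [set y | dot x y = 2^-1 * dot x x].

Definition colony Gamma : set E3 := [set x | Gamma `&` bisector x !=set0].

Definition discrete_set X : Prop := X `<=` isolated X.

Definition packing K X : Prop :=
  discrete_set X /\ trivIset X (fun x => (translate K x)°).

Definition effective_neighbour Gamma K x : Prop :=
  colony Gamma x /\ K° `&` translate K x = set0.

(* The maximum is taken as a supremum of cardinalities in \bar R, with
   [counting] equal to +oo on infinite sets, so that no finiteness is assumed.
   The point 0 of X is never counted when K° is nonempty. *)
Definition max_neighbours Gamma K : \bar R :=
  ereal_sup [set counting [set x | X x /\ effective_neighbour Gamma K x]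
            | X in [set X | packing K X /\ X 0]].

End Truncaters.

(* Main.v *)
(* The map x |-> (<s,x>)_s, with s running over one of each pair of opposite
   sign vectors in {1, -1}^3, is an isometry of l_1^3 into l_oo^4, so a
   half-open cube of side 2 in R^4 contains the image of at most one point of a
   packing by octahedra. Every neighbour x satisfies |x|_1 >= 2 and
   |x|^2 <= 4 r_1^2 = 428/171. A finite weighted family of cubes of total weight
   3168 is exhibited which covers each point of this shell with weight at least
   138; since 3168 < 23 * 138, there are at most 22 neighbours. The covering
   property depends only on the cell of the grid of mesh 1/6 containing the
   point, hence is checked by a finite computation. *)
Require Import Defs.
From HB Require Import structures.
From mathcomp Require Import all_boot all_order all_algebra.
From mathcomp Require Import all_classical all_reals all_analysis.
From mathcomp Require Import ring lra zify.
Import Order.TTheory GRing.Theory Num.Theory.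
Import numFieldNormedType.Exports.

Local Open Scope classical_set_scope.
Local Open Scope ring_scope.

(** * Grid cells and the weighted family of cubes *)

Implicit Types (c : int) (k p : seq int) (T : seq (seq int * nat)).

(* All lengths in R^4 are measured in sixths: a cube has side 12. *)
Definition inside (a c : int) : bool := (a <= c) && (c < a + 12).

Definition weight T k : nat :=
  (\sum_(bw <- T) all2 inside bw.1 k * bw.2)%N.

(* The integer Posz n stands for the interval [n, n + 1[ and Negz n = - n - 1
   for ]- n - 1, - n], so that n bounds the absolute value from below in both
   cases. *)
Definition magnitude c : nat := match c with Posz n => n | Negz n => n end.

(* Necessary conditions for a product of four such intervals to meet the image
   of the shell: that image lies in the hyperplane of vectors of sum 0, and
   36 * 4 * 428 / 171 < 361. *)
Definition cell k : bool :=
  [&& - 3 <= foldr +%R 0 k <= - 1, has (fun c => 12 <= magnitude c)%N k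
    & (sumn [seq magnitude c ^ 2 | c <- k] <= 360)%N].

(* Corners of cubes up to permutation and reflection, with weights: a rounded,
   sparse solution of the linear program for fractional coverings by cubes. *)
Definition base_cubes : seq (seq int * nat) :=
  [:: ([:: -24; -1; 0; 1], 2%N); ([:: -23; -3; 1; 2], 3%N);
      ([:: -23; -2; -2; 2], 6%N); ([:: -21; -7; 1; 2], 5%N);
      ([:: -21; -5; -3; 4], 6%N); ([:: -20; -11; 3; 3], 6%N);
      ([:: -20; -9; -1; 4], 3%N); ([:: -20; -8; 0; 3], 7%N);
      ([:: -19; -4; -3; 4], 6%N); ([:: -17; -10; 0; 4], 5%N);
      ([:: -17; -8; -1; 4], 9%N); ([:: -17; -6; -2; 4], 6%N);
      ([:: -16; -13; 2; 3], 8%N)]%Z.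

(* The opposite of the interval coded by c is coded by - 1 - c, so the opposite
   of the cube with corner a has corner - 12 - a. *)
Definition reflect_cubes T :=
  [seq ([seq - 12 - c | c <- aw.1], aw.2) | aw <- T].

Definition permute_cubes T :=
  [seq (b, aw.2) | aw <- T, b <- permutations aw.1].

Definition cubes := permute_cubes (base_cubes ++ reflect_cubes base_cubes).

Definition slice c T :=
  [seq (behead bw.1, bw.2) | bw <- T & inside (head 0 bw.1) c].

Definition entries : seq int :=
  [seq Negz n | n <- iota 0 19] ++ [seq Posz n | n <- iota 0 19].

(* Depth-first search over the nondecreasing cells; p lists the entries chosen
   so far, last one first, and T the cubes which still contain them. *)
Fixpoint check (d : nat) p T : bool :=
  if d is d'.+1 then
    all (fun c => if (0 < d')%N || cell (c :: p) then
                    check d' (c :: p) (slice c T) else true)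
        [seq c <- entries | head c p <= c]
  else (138 <= sumn [seq bw.2 | bw <- T])%N.

Arguments entries : simpl never.
Arguments cubes : simpl never.
Arguments cell : simpl never.
Arguments check : simpl never.

(** * Correctness of the finite search *)

Lemma size_cubes : all (fun bw => size bw.1 == 4%N) cubes.
Proof. by vm_compute. Qed.

Lemma check_cubes : check 4 [::] cubes.
Proof. by vm_compute. Qed.

Lemma weight_slice c k T (d : nat) :
  all (fun bw => size bw.1 == d.+1) T ->
  weight (slice c T) k = weight T (c :: k).
Proof.
rewrite /weight /slice big_map big_filter; elim: T => [|[[|a b] w] T IH] //=.
  by rewrite !big_nil.
move=> /andP[_ /IH {}IH]; rewrite !big_cons /= IH.
by case: inside.
Qed.

(** The chosen entries are kept in reverse, so the full cell is read as [catrev k p], nonincreasing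
    when the entries were chosen in nondecreasing order. *)
Lemma check_sound (d : nat) p T k :
  all (fun bw => size bw.1 == d) T -> check d p T -> size k = d ->
  {subset k <= entries} -> sorted >=%O (catrev k p) -> cell (catrev k p) ->
  (138 <= weight T k)%N.
Proof.
elim: d p T k => [|d IH] p T k sT.
  rewrite /check => le138 /size0nil -> _ _ _; apply: leq_trans le138 _.
  rewrite sumnE big_map /weight big_seq [leqRHS]big_seq.
  apply: leq_sum => bw /(allP sT); rewrite size_eq0 => /eqP ->.
  by rewrite mul1n.
rewrite /check -/check => /allP chk; case: k => [//|c k] [sk] ksub srt cl.
have cp : head c p <= c.
  move: srt => /=; rewrite catrevE => /cat_sorted2[_].
  by case: (p) => //= c' p' /andP[].
have := chk c; rewrite mem_filter cp ksub ?mem_head// => /(_ isT).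
rewrite -(@weight_slice _ _ _ d)//.
have -> : (0 < d)%N || cell (c :: p).
  by case: d k sk cl {IH chk sT ksub srt} => // -[].
move=> chk'; apply: IH chk' _ _ _ _ => //.
- rewrite all_map; apply/allP => bw; rewrite mem_filter => /andP[_] /(allP sT).
  by rewrite /= size_behead => /eqP ->.
- by move=> c' c'k; apply: ksub; rewrite inE c'k orbT.
Qed.

Lemma cell_entries k : cell k -> {subset k <= entries}.
Proof.
move=> /and3P[_ _ le360] c ck.
have : (magnitude c < 19)%N.
  rewrite ltnNge -leq_sqr -ltnNge.
  apply: leq_ltn_trans (leq_ltn_trans le360 _) => //.
  by rewrite sumnE big_map (big_rem c)//= leq_addr.
case: c {ck} => n /= n19; rewrite mem_cat; apply/orP; [right|left].
all: by apply: map_f; rewrite mem_iota.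
Qed.

(** * Symmetry under permutations of coordinates *)

Lemma cell_perm k k' : perm_eq k k' -> cell k = cell k'.
Proof.
move=> kk'; rewrite /cell (perm_has _ kk') (perm_sumn (perm_map _ kk')).
by rewrite !foldrE (perm_big _ kk').
Qed.

Lemma all2_map_nth I b k :
  all2 inside [seq nth 0 b i | i <- I] [seq nth 0 k i | i <- I] =
  all (fun i => inside (nth 0 b i) (nth 0 k i)) I.
Proof. by elim: I => //= i I ->. Qed.

Lemma all2_perm I b k : size b = size k -> perm_eq I (iota 0 (size k)) ->
  all2 inside [seq nth 0 b i | i <- I] [seq nth 0 k i | i <- I] =
  all2 inside b k.
Proof.
move=> bk Ik; rewrite all2_map_nth (perm_all _ Ik) -all2_map_nth.
by rewrite map_nth_iota0 ?bk// map_nth_iota0// -{1}bk !take_size.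
Qed.

(** Reindexing by [I] is injective and maps the permutations of [a] to themselves, so by finiteness
    it is a bijection. *)
Lemma perm_permutations I (a : seq int) : perm_eq I (iota 0 (size a)) ->
  perm_eq [seq [seq nth 0 b i | i <- I] | b <- permutations a] (permutations a).
Proof.
move=> Ia.
have sb b : b \in permutations a -> size b = size a.
  by rewrite mem_permutations => /perm_size.
have Im : uniq [seq [seq nth 0 b i | i <- I] | b <- permutations a].
  rewrite map_inj_in_uniq ?permutations_uniq// => b b' /sb ba /sb b'a.
  move=> /eq_in_map eqbb'; apply: (@eq_from_nth _ 0); first by rewrite ba.
  by move=> i ib; apply: eqbb'; rewrite (perm_mem Ia) mem_iota -ba.
apply: uniq_perm => //; first exact: permutations_uniq.
apply: (uniq_min_size Im _ _).2; last by rewrite size_map.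
move=> _ /mapP[b ba ->]; rewrite mem_permutations.
move: (ba); rewrite mem_permutations; apply: perm_trans.
by rewrite (perm_trans (perm_map _ Ia))// -(sb _ ba) map_nth_iota0// take_size.
Qed.

Lemma weight_perm T k k' : all (fun aw => size aw.1 == size k) T ->
  perm_eq k' k -> weight (permute_cubes T) k' = weight (permute_cubes T) k.
Proof.
move=> sT /(perm_iotaP 0)[I Ik ->].
rewrite /weight /permute_cubes !big_allpairs_dep big_seq [RHS]big_seq /=.
apply: eq_bigr => aw /(allP sT)/eqP sa.
rewrite -(perm_big _ (perm_permutations _ _ (_ : perm_eq I _))) ?sa//= big_map.
rewrite big_seq [RHS]big_seq; apply: eq_bigr => b.
by rewrite mem_permutations => /perm_size ba; rewrite all2_perm// ba.
Qed.

Lemma weight_cubes k : size k = 4%N -> cell k -> (138 <= weight cubes k)%N.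
Proof.
move=> k4 ck; have sk : perm_eq (sort <=%O k) k by rewrite perm_sort.
rewrite -(@weight_perm _ _ _ _ sk) ?k4 //.
apply: (check_sound 4 [::] cubes _ size_cubes check_cubes).
- by rewrite size_sort.
- by move=> c; rewrite mem_sort; apply: cell_entries.
- by rewrite catrevE cats0 rev_sorted sort_sorted//; apply: le_total.
- by rewrite catrevE cats0 (cell_perm _ _ (_ : perm_eq _ k))// perm_rev.
Qed.

Lemma total_weight : (\sum_(bw <- cubes) bw.2 = 3168)%N.
Proof. by rewrite -(big_map snd xpredT id) -sumnE; vm_compute. Qed.

(** * From points of the shell to grid cells *)

Section Shell.
Context {R : realType}.
Implicit Types (t u : R) (x y : 'rV[R]_3).

Definition digit t : int :=
  if 0 <= t then Posz (Num.truncn (6 * t)) else Negz (Num.truncn (- (6 * t))).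

Lemma digit_itv t : if 0 <= t then (digit t)%:~R <= 6 * t < (digit t)%:~R + 1
                    else (digit t)%:~R < 6 * t <= (digit t)%:~R + 1.
Proof.
rewrite /digit; have [t0|t0] := leP 0 t.
  have /truncn_itv : 0 <= 6 * t by rewrite mulr_ge0.
  by move: (Num.truncn _) => n; rewrite -(natr1 n) -pmulrn.
have /truncn_itv : 0 <= - (6 * t) by lra.
move: (Num.truncn _) => n; rewrite NegzE mulrNz -pmulrn -(natr1 n).
by move: (n%:R : R) => r; lra.
Qed.

(** Both [6 * t] and [6 * u] lie in [[a, a + 12]]. The lower end is attained only by a nonnegative
    number and the upper end only by a negative one, so not both are attained. *)
Lemma digit_inside (a : int) t u :
  inside a (digit t) -> inside a (digit u) -> `|t - u| < 2.
Proof.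
rewrite /inside => /andP[at_ ta] /andP[au ua].
move: (digit_itv t) (digit_itv u); move: (digit t) (digit u) at_ ta au ua.
move=> m n; rewrite -!lezD1 -!(ler_int R) !rmorphD /= ltr_norml.
move: (a%:~R : R) (m%:~R : R) (n%:~R : R) => a' m' n'.
by case: (leP 0 t) => t0; case: (leP 0 u) => u0; lra.
Qed.

Lemma magnitude_digit t :
  (magnitude (digit t))%:R <= 6 * `|t| < (magnitude (digit t)).+1%:R.
Proof.
rewrite /digit; have [t0|t0] := leP 0 t => /=.
  by rewrite ger0_norm// truncn_itv// mulr_ge0.
by rewrite ltr0_norm// -mulrN truncn_itv//; lra.
Qed.

(* The signs are chosen so that the four values sum to 0; their squares then
   sum to 4 |x|^2. *)
Definition facets x : seq R :=
  [:: - (x 0 0 + x 0 1 + x 0 2%:R); x 0 0 + x 0 1 - x 0 2%:R;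
      x 0 0 - x 0 1 + x 0 2%:R; - x 0 0 + x 0 1 + x 0 2%:R].

Definition l1norm x : R := \sum_i `|x 0 i|.

Lemma sum_I3 (F : 'I_3 -> R) : \sum_i F i = F 0 + F 1 + F 2%:R.
Proof.
rewrite !big_ord_recl big_ord0 addr0 addrA.
by congr (_ + F _ + F _); apply: val_inj.
Qed.

(** The signs of the coordinates of [x] select a facet value equal to [l1norm x] up to sign. *)
Lemma l1norm_ge2 x : 2 <= l1norm x -> has (fun t => 2 <= `|t|) (facets x).
Proof.
rewrite /l1norm sum_I3 /=; move: (x 0 0) (x 0 1) (x 0 2%:R) => a b c.
by rewrite orbF !ler_normr; do 3 (case: ger0P => ?); lra.
Qed.

Lemma l1norm_lt2 x y :
  all2 (fun t u => `|t - u| < 2) (facets x) (facets y) -> l1norm (x - y) < 2.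
Proof.
rewrite /l1norm sum_I3 /= !mxE andbT !ltr_norml.
move: (x 0 0) (x 0 1) (x 0 2%:R) (y 0 0) (y 0 1) (y 0 2%:R).
by move=> a b c a' b' c'; do 3 (case: ger0P => ?); lra.
Qed.

Lemma cell_digits t1 t2 t3 t4 : t1 + t2 + t3 + t4 = 0 ->
  t1 ^+ 2 + t2 ^+ 2 + t3 ^+ 2 + t4 ^+ 2 <= 1712 / 171 ->
  has (fun t => 2 <= `|t|) [:: t1; t2; t3; t4] ->
  cell [seq digit t | t <- [:: t1; t2; t3; t4]].
Proof.
move=> t0 sumsq /= far.
have sq t : ((magnitude (digit t) ^ 2)%N%:R : R) <= 36 * t ^+ 2.
  have /andP[le_mt _] := magnitude_digit t.
  rewrite natrX; have := lerXn2r 2 _ _ le_mt.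
  rewrite !nnegrE ler0n mulr_ge0// => /(_ isT isT).
  by rewrite exprMn real_normK ?num_real//; lra.
have big t : 2 <= `|t| -> (12 <= magnitude (digit t))%N.
  move=> t2'; rewrite -ltnS -(ltr_nat R).
  by have /andP[_ +] := magnitude_digit t; apply: le_lt_trans; lra.
rewrite /cell; apply/and3P; split.
(* Sum -4 would force all four values negative; sum 0 would force them nonnegative, hence zero,
   against [far]. *)
- suff lt0 : -4 < digit t1 + (digit t2 + (digit t3 + digit t4)) < 0.
    by move: lt0; rewrite /= addr0; lia.
  rewrite -(ltr_int R) -[X in _ && X](ltr_int R) !rmorphD /=.
  move: (digit_itv t1) (digit_itv t2) (digit_itv t3) (digit_itv t4) far.
  move: ((digit t1)%:~R : R) ((digit t2)%:~R : R) ((digit t3)%:~R : R)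
        ((digit t4)%:~R : R) => d1 d2 d3 d4.
  rewrite !ler_normr orbF.
  case: (leP 0 t1) => ?; case: (leP 0 t2) => ?; case: (leP 0 t3) => ?;
  case: (leP 0 t4) => ?; lra.
- move: far => /= /or4P[||/big->|/orP[/big->|//]]; rewrite ?orbT//.
    by move=> /big ->.
  by move=> /big ->; rewrite orbT.
- rewrite -ltnS -(ltr_nat R) /= !natrD addr0.
  have := (sq t1, sq t2, sq t3, sq t4) => -[[[s1 s2] s3] s4].
  lra.
Qed.

Lemma facets_cell x : dot x x <= 428 / 171 -> 2 <= l1norm x ->
  cell [seq digit t | t <- facets x].
Proof.
rewrite /dot sum_I3 => dx /l1norm_ge2 far.
by apply: cell_digits far; [ring|nra].
Qed.

(** * Double counting of points and cubes *)

Lemma count_le1 (T : eqType) (P : pred T) (s : seq T) : uniq s ->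
  {in s &, forall a b, P a -> P b -> a = b} -> (count P s <= 1)%N.
Proof.
move=> us inj; rewrite -size_filter.
case E : [seq z <- s | P z] => [|a [|b r]] //.
have := filter_uniq P us; rewrite E /= inE negb_or => /andP[/andP[/eqP ab _] _].
case: ab.
have : a \in [seq z <- s | P z] by rewrite E mem_head.
have : b \in [seq z <- s | P z] by rewrite E !inE eqxx orbT.
by rewrite !mem_filter => /andP[Pb bs] /andP[Pa as_]; apply: inj.
Qed.

Lemma size_separated (s : seq 'rV[R]_3) : uniq s ->
  {in s, forall x, dot x x <= 428 / 171 /\ 2 <= l1norm x} ->
  {in s &, forall x y, l1norm (x - y) < 2 -> x = y} -> (size s <= 22)%N.
Proof.
move=> us shell sep; pose k x := [seq digit t | t <- facets x].
have one b : size b = 4%N -> (count (fun x => all2 inside b (k x)) s <= 1)%N.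
  move=> sb; apply: count_le1 => // x y xs ys bx by_; apply: sep => //.
  apply: l1norm_lt2; move: bx by_; rewrite /k /facets /=.
  case: b sb => [|b1 [|b2 [|b3 [|b4 [|//]]]]]//= _.
  move=> /and5P[x1 x2 x3 x4 _] /and5P[y1 y2 y3 y4 _].
  by rewrite !(digit_inside _ _ _ x1 y1, digit_inside _ _ _ x2 y2,
               digit_inside _ _ _ x3 y3, digit_inside _ _ _ x4 y4).
suff : (size s * 138 <= 3168)%N by lia.
rewrite -total_weight mulnC -sum1_size big_distrr /=.
apply: (@leq_trans (\sum_(x <- s) weight cubes (k x))%N).
  rewrite big_seq [leqRHS]big_seq; apply: leq_sum => x xs; rewrite muln1.
  by have [dx lx] := shell x xs; apply: weight_cubes => //; apply: facets_cell.
rewrite /weight exchange_big /= big_seq [leqRHS]big_seq.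
apply: leq_sum => bw bwc; rewrite -big_distrl /= -[leqRHS]mul1n leq_mul2r.
apply/orP; right.
have /eqP sb := allP size_cubes _ bwc.
apply: leq_trans (one _ sb); rewrite -sum1_count [leqRHS]big_mkcond /=.
by apply: leq_sum => x _; case: all2.
Qed.

End Shell.

(** * Octahedra, packings and the colony of a ball *)

Section Packing.
Context {R : realType}.
Implicit Types (x y z : 'rV[R]_3) (X : set 'rV[R]_3).

Lemma interior_translate x z :
  l1norm (z - x) < 1 -> (translate octahedron x)° z.
Proof.
(* Library balls are for the sup norm, and the l_1 norm is at most 3 times it. *)
move=> zx; apply/nbhs_ballP; exists ((1 - l1norm (z - x)) / 3) => /=.
  by rewrite divr_gt0// subr_gt0.
move=> y zy; exists (y - x); last by rewrite subrK.
move: zx zy => /=; rewrite /octahedron /= /ball /= /mx_ball /l1norm !sum_I3.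
rewrite !mxE => zx [_ zy]; move: (zy 0 0) (zy 0 1) (zy 0 2%:R) zx.
rewrite /ball /=.
move: (x 0 0) (x 0 1) (x 0 2%:R) (y 0 0) (y 0 1) (y 0 2%:R).
move: (z 0 0) (z 0 1) (z 0 2%:R) => z1 z2 z3 x1 x2 x3 y1 y2 y3.
have tri (u v w : R) : `|v - u| <= `|w - u| + `|w - v|.
  by rewrite [leRHS]addrC (distrC w v) ler_distD.
move=> /= e1 e2 e3 h.
have := (tri x1 y1 z1, tri x2 y2 z2, tri x3 y3 z3) => -[[t1 t2] t3].
lra.
Qed.

Lemma interior_octahedron x : l1norm x < 1 -> octahedron° x.
Proof.
move=> x1; have := @interior_translate 0 x; rewrite subr0 => /(_ x1).
by congr (interior _ x); apply/seteqP; split=> [_ [y Ky <-]|y Ky];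
  [rewrite addr0|exists y; rewrite ?addr0].
Qed.

Lemma l1normZ (a : R) x : l1norm (a *: x) = `|a| * l1norm x.
Proof.
by rewrite /l1norm mulr_sumr; apply: eq_bigr => i _; rewrite mxE normrM.
Qed.

Lemma packing_separated X x y : packing octahedron X -> X x -> X y ->
  l1norm (x - y) < 2 -> x = y.
Proof.
move=> [_ tX] Xx Xy xy; apply: (tX x y Xx Xy).
(* The midpoint would be interior to both translates. *)
exists (2^-1 *: (x + y)); split; apply: interior_translate.
  rewrite (_ : _ - x = (- 2^-1) *: (x - y)); last first.
    by apply/rowP => i; rewrite !mxE; field.
  by rewrite l1normZ normrN ger0_norm ?invr_ge0//; lra.
rewrite (_ : _ - y = 2^-1 *: (x - y)); last first.
  by apply/rowP => i; rewrite !mxE; field.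
by rewrite l1normZ ger0_norm ?invr_ge0//; lra.
Qed.

Lemma colony_ball (r : R) x :
  colony (dilate r unit_ball) x -> dot x x <= 4 * r ^+ 2.
Proof.
case=> _ [[y /= y1 <-]]; rewrite /bisector /=.
have {y1} : dot y y <= 1.
  move: y1; rewrite /unit_ball /= /enorm -{1}sqrtr1 ler_sqrt// ler01.
move=> yy; rewrite /dot sum_I3 in yy *; rewrite !sum_I3 !mxE.
move: yy (x 0 0) (x 0 1) (x 0 2%:R); move: (y 0 0) (y 0 1) (y 0 2%:R).
move=> a b c yy d e f xy.
have cs : (d * a + e * b + f * c) ^+ 2 <=
          (d * d + e * e + f * f) * (a * a + b * b + c * c).
  have := (sqr_ge0 (d * b - e * a), sqr_ge0 (d * c - f * a),
           sqr_ge0 (e * c - f * b)).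
  by move=> -[[s1 s2] s3]; nra.
have {}xy : d * d + e * e + f * f = 2 * (r * (d * a + e * b + f * c)) by lra.
have D0 : 0 <= d * d + e * e + f * f by rewrite !addr_ge0// -expr2 sqr_ge0.
move: (d * d + e * e + f * f) (d * a + e * b + f * c) (a * a + b * b + c * c)
  D0 cs xy yy => D q n D0 cs xy n1.
(* Cauchy-Schwarz gives [q ^+ 2 <= D * n] with [n <= 1]; squaring [D = 2 * (r * q)] avoids any sign
   condition on [r]. *)
have : D * D <= D * (4 * r ^+ 2).
  have -> : D * D = 4 * r ^+ 2 * q ^+ 2 by rewrite {1 2}xy; ring.
  rewrite [leRHS]mulrC; apply: ler_wpM2l; first by rewrite mulr_ge0 ?sqr_ge0.
  by apply: le_trans cs _; rewrite -[leRHS]mulr1; apply: ler_wpM2l.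
have [->|Dn0] := eqVneq D 0; first by rewrite mulr_ge0 ?sqr_ge0.
by rewrite ler_pM2l// lt_def Dn0.
Qed.

Lemma neighbour_l1norm x :
  octahedron° `&` translate octahedron x = set0 -> 2 <= l1norm x.
Proof.
move=> disj; rewrite leNgt; apply/negP => x2.
(* The point [x / 2] is also [- x / 2 + x]. *)
have : (octahedron° `&` translate octahedron x) (2^-1 *: x).
  split; first by apply: interior_octahedron; rewrite l1normZ ger0_norm; lra.
  exists (- 2^-1 *: x); last first.
    by rewrite -[X in _ + X = _]scale1r -scalerDl; congr (_ *: _); field.
  rewrite /octahedron /= -/(l1norm _) l1normZ normrN ger0_norm; lra.
by rewrite disj.
Qed.

End Packing.

Theorem theorem4p5 (R : realType) :
  (max_neighbours (dilate (Num.sqrt 2033 / 57 : R) unit_ball) octahedron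
     <= (22 : R)%:E)%E.
Proof.
apply: ub_ereal_sup => _ [X [pX _] <-]; set A := [set x | _].
have bound (s : seq 'rV[R]_3) :
    uniq s -> {in s, forall x, A x} -> (size s <= 22)%N.
  move=> us sA; apply: (@size_separated R) => // [x xs|x y xs ys].
    have [_ [Gx disj]] := sA x xs; split; last exact: neighbour_l1norm.
    apply: le_trans (colony_ball _ _ Gx) _.
    (* Here 4 * 2033 / 57^2 = 428 / 171. *)
    rewrite expr_div_n (sqr_sqrtr (ler0n R 2033)); lra.
  have [[Xx _] [Xy _]] := (sA x xs, sA y ys).
  exact: packing_separated pX Xx Xy.
(* An infinite [A] would contain 23 distinct points, against [bound]. *)
have finA : finite_set A.
  apply: contrapT => /infinite_set_fset -/(_ 23)[B BA].
  by rewrite leqNgt ltnS bound ?finmap.fset_uniq// => x xB; apply: BA.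
rewrite /counting asboolT// lee_fin ler_nat bound ?finmap.fset_uniq// => x.
by rewrite in_fset_set// inE.
Qed.
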